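(* Let $K$ be any field and let $G$ be a connected simple graph on the vertex set $[n]=\{1,\ldots,n\}$ with $m$ edges. Let $J_G\subset K[x_1,\ldots,x_{2n}]$ be the binomial edge ideal of $G$. Then $\mathrm{bar}(J_G)=\mathrm{ara}_c(J_G)=m$.
   Context: The binomial edge ideal $J_G\subset R=K[x_1,\ldots,x_n,x_{n+1},\ldots,x_{2n}]$ of $G$ is the ideal generated by the binomials $f_{ij}=x_ix_{n+j}-x_jx_{n+i}$, $i<j$, with $\{i,j\}$ an edge of $G$. A binomial is a difference of two monomials. For an ideal $J$ generated by binomials, a polynomial $F=c_1M_1+\cdots+c_sM_s\in J$ (with $c_i\in K$ nonzero and $M_1,\ldots,M_s$ distinct monomials) is $J$-complete if $M_i-M_l\in J$ for all $1\le i<l\le s$. The binomial arithmetical rank $\mathrm{bar}(J)$ is the smallest $s$ for which there exist binomials $B_1,\ldots,B_s\in J$ with $\mathrm{rad}(J)=\mathrm{rad}(B_1,\ldots,B_s)$. The $J$-complete arithmetical rank $\mathrm{ara}_c(J)$ is the smallest $s$ for which there exist $J$-complete polynomials $F_1,\ldots,F_s\in J$ with $\mathrm{rad}(J)=\mathrm{rad}(F_1,\ldots,F_s)$. *)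

(* Defs.v *)
From mathcomp Require Import all_boot all_algebra.
From mathcomp Require Import mpoly.

Set Implicit Arguments.
Unset Strict Implicit.
Unset Printing Implicit Defensive.

Import GRing.Theory.
Local Open Scope ring_scope.

(* Ideals are Prop-valued predicates: the boolean ideals of ring_quotient would
   require membership to be decidable. *)
Definition ideal_gen (R : comNzRingType) (S : R -> Prop) (f : R) : Prop :=
  exists2 s : seq (R * R),
    (forall p, p \in s -> S p.2) & f = \sum_(p <- s) p.1 * p.2.

Definition family_ideal (R : comNzRingType) (s : nat) (F : 'I_s -> R) :
  R -> Prop := ideal_gen (fun g => exists i, g = F i).

Definition radical (R : comNzRingType) (J : R -> Prop) (f : R) : Prop :=
  exists k : nat, J (f ^+ k).

Definition same_radical (R : comNzRingType) (I J : R -> Prop) : Prop :=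
  forall f : R, radical I f <-> radical J f.

Definition is_least (P : nat -> Prop) (s : nat) : Prop :=
  P s /\ forall t, P t -> (s <= t)%N.

Section BinomialIdeals.
Variables (K : fieldType) (N : nat).
Implicit Types (J : {mpoly K[N]} -> Prop) (F : {mpoly K[N]}).

(* The two monomials may coincide, so 0 counts as a binomial; this does not
   affect the minimum in is_bar, since zero generators can be dropped. *)
Definition is_binomial F : Prop :=
  exists a b : 'X_{1..N}, F = 'X_[a] - 'X_[b].

Definition is_complete J F : Prop :=
  J F /\ forall a b : 'X_{1..N},
    a \in msupp F -> b \in msupp F -> a != b -> J ('X_[a] - 'X_[b]).

(* is_bar J s reads "bar(J) = s". *)
Definition is_bar J : nat -> Prop :=
  is_least (fun s => exists B : 'I_s -> {mpoly K[N]},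
    (forall i, J (B i) /\ is_binomial (B i)) /\
    same_radical J (family_ideal B)).

(* is_ara_c J s reads "ara_c(J) = s". *)
Definition is_ara_c J : nat -> Prop :=
  is_least (fun s => exists F : 'I_s -> {mpoly K[N]},
    (forall i, is_complete J (F i)) /\
    same_radical J (family_ideal F)).

End BinomialIdeals.

Section BinomialEdgeIdeal.
Variables (K : fieldType) (n : nat).

(* With 0-based indices, x_i is 'X_(lshift n i) and x_(n+j) is 'X_(rshift n j). *)
Definition edge_binomial (i j : 'I_n) : {mpoly K[n + n]} :=
  'X_(lshift n i) * 'X_(rshift n j) - 'X_(lshift n j) * 'X_(rshift n i).

Definition binomial_edge_ideal (e : rel 'I_n) : {mpoly K[n + n]} -> Prop :=
  ideal_gen (fun g => exists i j : 'I_n,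
    [/\ (i < j)%N, e i j & g = edge_binomial i j]).

End BinomialEdgeIdeal.

Arguments binomial_edge_ideal K {n} e _.

Definition connected_graph (n : nat) (e : rel 'I_n) : Prop :=
  (0 < n)%N /\ forall x y : 'I_n, connect e x y.

(* Each edge {i, j} is represented once, by the pair with i < j. *)
Definition edges (n : nat) (e : rel 'I_n) : {set 'I_n * 'I_n} :=
  [set p : 'I_n * 'I_n | (p.1 < p.2)%N && e p.1 p.2].

(* Main.v *)
From HB Require Import structures.
Require Import Defs.
From mathcomp Require Import all_boot all_algebra.
From mathcomp Require Import mpoly.

(** Write v(M) for the set of vertices i such that x_i or x_(n+i) divides the
    monomial M.  If M - M' lies in J_G then v(M) = v(M'), so every J_G-complete
    polynomial F has a well-defined vertex set v(F).  Setting the variables of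
    all the vertices but one to zero kills J_G, so v(F) is not contained in a
    singleton when F is nonzero.  Given an edge {i, j}, set all the variables
    of the other vertices to zero: f_ij is unchanged, so a generator F_l
    survives, and then v(F_l) = {i, j}.  Hence at least m generators are needed. *)

Set Implicit Arguments.
Unset Strict Implicit.
Unset Printing Implicit Defensive.

Import GRing.Theory.
Local Open Scope ring_scope.

Section IdealGen.
Variables (R S : comNzRingType).

Lemma ideal_gen_incl (P : R -> Prop) g : P g -> ideal_gen P g.
Proof.
move=> Pg; exists [:: (1, g)]; last by rewrite big_seq1 mul1r.
by move=> p; rewrite inE => /eqP->.
Qed.

Lemma ideal_genN (P : R -> Prop) g : ideal_gen P g -> ideal_gen P (- g).
Proof.
case=> s Ps ->; exists [seq (- p.1, p.2) | p <- s].
  by move=> p /mapP[q /Ps Pq ->].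
by rewrite big_map -sumrN; apply: eq_bigr => p _; rewrite mulNr.
Qed.

Lemma eq_ideal_gen (P Q : R -> Prop) :
  (forall g, P g <-> Q g) -> forall f, ideal_gen P f <-> ideal_gen Q f.
Proof. by move=> PQ f; split=> -[s Ps ->]; exists s => // p /Ps /PQ. Qed.

(** Used below with an evaluation at a point and with a restriction to a vertex set. *)
Lemma rmorph_ideal_gen0 (P : R -> Prop) (phi : {rmorphism R -> S}) f :
  (forall g, P g -> phi g = 0) -> ideal_gen P f -> phi f = 0.
Proof.
move=> phi0 [s Ps ->]; rewrite rmorph_sum big_seq big1 // => p /Ps /phi0.
by rewrite rmorphM => ->; rewrite mulr0.
Qed.

End IdealGen.

(** At most two monomials occur, so the only differences to test are [F] and [- F]. This transfers
    lower bounds from complete polynomials to binomials. *)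
Lemma binomial_complete (K : fieldType) (N : nat) (P : {mpoly K[N]} -> Prop) F :
  ideal_gen P F -> is_binomial F -> is_complete (ideal_gen P) F.
Proof.
move=> PF [a [b F_ab]]; split=> // c d; rewrite F_ab.
have supp_ab x : x \in msupp ('X_[a] - 'X_[b] : {mpoly K[N]}) -> x = a \/ x = b.
  by move/msuppB_le; rewrite mem_cat !msuppX !inE => /orP[]/eqP; auto.
have PN : ideal_gen P ('X_[b] - 'X_[a]) by rewrite -opprB -F_ab; apply: ideal_genN.
by move=> /supp_ab[]-> /supp_ab[]->; rewrite ?eqxx -?F_ab.
Qed.

Section VertexSets.
Variables (K : fieldType) (n : nat) (e : rel 'I_n).
Local Notation J := (binomial_edge_ideal K e).
Local Notation P := {mpoly K[n + n]}.
Implicit Types (a b : 'X_{1..n + n}) (A : {set 'I_n}) (F : P).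

Definition vertex (k : 'I_(n + n)) : 'I_n :=
  match split k with inl i => i | inr i => i end.

Lemma vertex_lshift i : vertex (lshift n i) = i.
Proof. by rewrite /vertex (unsplitK (inl i)). Qed.

Lemma vertex_rshift i : vertex (rshift n i) = i.
Proof. by rewrite /vertex (unsplitK (inr i)). Qed.

Definition vset a : {set 'I_n} := [set vertex k | k in [pred k | a k != 0%N]].

Lemma vset_subP a A :
  reflect (forall k, a k != 0%N -> vertex k \in A) (vset a \subset A).
Proof.
apply: (iffP subsetP) => [sub k ak | sub i].
  by apply: sub; apply/imsetP; exists k; rewrite ?inE.
by case/imsetP=> k; rewrite inE => /sub kA ->.
Qed.

(* Evaluate at the point with x_i = x_(n+i) = 1 for i in vset a, and 0 elsewhere:
   it is a zero of every f_ij. *)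
Lemma vset_sub_binomial a b : J ('X_[a] - 'X_[b]) -> vset b \subset vset a.
Proof.
pose v (k : 'I_(n + n)) : K := (vertex k \in vset a)%:R.
move=> /(rmorph_ideal_gen0 (phi := meval v)) H.
have /H : forall g : P, (exists i j : 'I_n,
    [/\ (i < j)%N, e i j & g = edge_binomial K i j]) -> meval v g = 0.
  move=> _ [i [j [_ _ ->]]]; rewrite /edge_binomial rmorphB !rmorphM /= !mevalXU.
  by rewrite /v !vertex_lshift !vertex_rshift mulrC subrr.
rewrite rmorphB /= !mevalX [X in X - _]big1 => [|k _]; last first.
  have [->|ak] := eqVneq (a k) 0%N; first by rewrite expr0.
  by rewrite /v (vset_subP _ _ (subxx _) k ak) expr1n.
move=> vb; apply/vset_subP => k bk; apply/negPn/negP => kNa.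
move: vb; rewrite (bigD1 k) //= /v (negPf kNa) expr0n (negPf bk) mul0r subr0.
by move/eqP; rewrite oner_eq0.
Qed.

Lemma complete_vset F a b : is_complete J F ->
  a \in msupp F -> b \in msupp F -> vset a = vset b.
Proof.
move=> [_ cF] aF bF; have [->//|ab] := eqVneq a b.
by apply/eqP; rewrite eqEsubset !vset_sub_binomial //; apply: cF => //; rewrite eq_sym.
Qed.

(** An endomorphism of the full ring rather than a map to a smaller one, so that polynomials in the
    variables of [A] are literally fixed. *)
Definition restr A : P -> P :=
  comp_mpoly [tuple if vertex k \in A then 'X_k else 0 | k < n + n].

HB.instance Definition _ A := GRing.RMorphism.on (restr A).

Lemma restrU A k : restr A 'X_k = if vertex k \in A then 'X_k else 0.
Proof. by rewrite /restr comp_mpolyXU -tnth_nth tnth_mktuple. Qed.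

Lemma restrX A a : restr A 'X_[a] = if vset a \subset A then 'X_[a] else 0.
Proof.
rewrite /restr comp_mpolyX; case: ifPn => [/vset_subP sub | /vset_subP nsub].
  rewrite [RHS]mpolyXE_id; apply: eq_bigr => k _; rewrite tnth_mktuple.
  have [->|/sub ->//] := eqVneq (a k) 0%N; by rewrite !expr0.
have /existsP[k /andP[ak kA]] : [exists k, (a k != 0%N) && (vertex k \notin A)].
  apply: contra_notT nsub => /existsPn noneNA k ak.
  by move: (noneNA k); rewrite ak negbK.
by rewrite (bigD1 k) //= tnth_mktuple (negPf kA) expr0n (negPf ak) mul0r.
Qed.

(** Each monomial is either fixed or killed, so terms are dropped without any cancellation. *)
Lemma restrE A F :
  restr A F = \sum_(a <- msupp F | vset a \subset A) F@_a *: 'X_[a].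
Proof.
rewrite {1}[F]mpolyE rmorph_sum /= [RHS]big_mkcond /=; apply: eq_bigr => a _.
rewrite -mul_mpolyC rmorphM /= restrX {1}/restr comp_mpolyC mul_mpolyC.
by case: ifP => _; rewrite ?mul_mpolyC ?scaler0.
Qed.

(** Both terms of a generator f_jk involve both endpoints, and j < k forces one of these to differ
    from [i]. *)
Lemma restr1_ideal i F : J F -> restr [set i] F = 0.
Proof.
apply: rmorph_ideal_gen0 => _ [j [k [jk _ ->]]].
rewrite /edge_binomial rmorphB !rmorphM /= !restrU !vertex_lshift !vertex_rshift.
rewrite !inE; have [ji|_] := eqVneq j i; last by rewrite mul0r mulr0 subrr.
have /negPf-> : k != i by rewrite -ji neq_ltn jk orbT.
by rewrite mul0r mulr0 subrr.
Qed.

(** By completeness all monomials of [F] share one vertex set; were it inside a singleton, the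
    restriction would leave [F] unchanged and yet kill it. *)
Lemma complete_vset_sub1 F a i :
  is_complete J F -> a \in msupp F -> ~~ (vset a \subset [set i]).
Proof.
move=> cF aF; apply/negP => ai; have [JF _] := cF.
have := restr1_ideal i JF; rewrite restrE big_seq_cond.
rewrite (eq_bigl (fun b => b \in msupp F)) => [|b]; last first.
  by case: (boolP (b \in msupp F)) => // bF; rewrite -(complete_vset cF aF bF) ai.
by rewrite -big_seq -mpolyE => F0; rewrite F0 msupp0 in aF.
Qed.

Lemma edge_binomial_neq0 (i j : 'I_n) : (i < j)%N -> edge_binomial K i j != 0.
Proof.
move=> ij; rewrite /edge_binomial -!mpolyXD subr_eq0.
apply/eqP => /(congr1 (mcoeff (U_(lshift n i) + U_(rshift n j))%MM)).
(* Equal monomials would have equal exponents at x_i, but these are 1 and 0; distinct monomials give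
   1 = 0 in [K]. *)
rewrite !mcoeffX eqxx; case: eqP => [/mnmP/(_ (lshift n i))|_ /eqP].
  rewrite !mnmDE !mnm1E eqxx !eq_rlshift eq_lshift.
  by rewrite -val_eqE /= gtn_eqF.
by rewrite oner_eq0.
Qed.

Lemma restr_edge_binomial (i j : 'I_n) :
  restr [set i; j] (edge_binomial K i j) = edge_binomial K i j.
Proof.
rewrite /edge_binomial rmorphB !rmorphM /= !restrU.
by rewrite !vertex_lshift !vertex_rshift !inE !eqxx !orbT.
Qed.

(** The leading monomial is just a canonical representative: all monomials of [F l] have the same
    vertex set. *)
Lemma vset_generator (t : nat) (F : 'I_t -> P) (i j : 'I_n) :
  (forall l, is_complete J (F l)) -> (i < j)%N ->
  radical (family_ideal F) (edge_binomial K i j) ->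
  exists l, vset (mlead (F l)) = [set i; j].
Proof.
move=> cF ij [k Fk].
(* Otherwise a power of f_ij, which the restriction fixes, would vanish in an integral domain. *)
have [l Fl0] : exists l, restr [set i; j] (F l) != 0.
  apply/existsP; apply: contraT => /existsPn all0.
  have: restr [set i; j] (edge_binomial K i j ^+ k) = 0.
    by apply: rmorph_ideal_gen0 Fk => _ [l ->]; apply/eqP/negbNE/all0.
  rewrite rmorphXn /= restr_edge_binomial => /eqP.
  by rewrite expf_eq0 (negPf (edge_binomial_neq0 ij)) andbF.
exists l.
have /hasP[a aF aij] : has (fun a => vset a \subset [set i; j]) (msupp (F l)).
  apply: contraNT Fl0 => /hasPn nhas; rewrite restrE big_seq_cond big_pred0 // => a.
  by apply/negP => /andP[/nhas /negPf->].
have F_neq0 : F l != 0 by apply: contraTneq aF => ->; rewrite msupp0.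
rewrite -(complete_vset (cF l) aF (mlead_supp F_neq0)).
apply/eqP; rewrite eqEsubset aij /=.
(* Stated for either ordering of the edge: if [x] were missing, [vset a] would lie in the singleton
   of [y]. *)
have mem_vset x y : [set i; j] = [set x; y] -> x \in vset a.
  move=> ij_xy; apply: contraR (complete_vset_sub1 y (cF l) aF) => xa.
  apply/subsetP => z za; have /subsetP/(_ z za) := aij.
  by rewrite ij_xy !inE; case: eqVneq => [zx|] //=; rewrite -zx za in xa.
by rewrite subUset !sub1set (mem_vset i j) ?(mem_vset j i) // setUC.
Qed.

Lemma edge_pair_inj : {in edges e &, injective (fun p => [set p.1; p.2])}.
Proof.
move=> [i j] [k l]; rewrite !inE /= => /andP[ij _] /andP[kl _] E.
have : (i \in [set k; l]) && (j \in [set k; l]) by rewrite -E !inE !eqxx orbT.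
rewrite !inE => /andP[/orP[]/eqP i_eq /orP[]/eqP j_eq]; subst i j => //.
- by rewrite ltnn in ij.
- by have := ltn_trans ij kl; rewrite ltnn.
- by rewrite ltnn in ij.
Qed.

Lemma complete_family_size (t : nat) (F : 'I_t -> P) :
  (forall l, is_complete J (F l)) -> same_radical J (family_ideal F) ->
  (#|edges e| <= t)%N.
Proof.
move=> cF radF; rewrite -(card_in_imset edge_pair_inj).
rewrite -[X in (_ <= X)%N]card_ord -cardsT.
(* The [t] generators have at most [t] vertex sets, and every edge must be among them. *)
apply: leq_trans (leq_imset_card (fun l => vset (mlead (F l))) setT).
apply/subset_leq_card/subsetP => A /imsetP[[i j]]; rewrite inE => /= /andP[ij eij] ->.
have [|l <-] := vset_generator cF ij; last by apply: imset_f.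
by apply/radF; exists 1%N; rewrite expr1; apply: ideal_gen_incl; exists i, j.
Qed.

End VertexSets.

(** Enumerating the edges turns the defining generators into a family of the size needed for the
    upper bounds. *)
Lemma edge_binomials_generate (K : fieldType) (n : nat) (e : rel 'I_n) f :
  binomial_edge_ideal K e f <->
  family_ideal (fun k : 'I_#|edges e| =>
    edge_binomial K (enum_val k).1 (enum_val k).2) f.
Proof.
apply: eq_ideal_gen => g; split=> [[i [j [ij eij ->]]] | [k ->]].
  have ije : (i, j) \in edges e by rewrite inE ij.
  by exists (enum_rank_in ije (i, j)); rewrite enum_rankK_in.
have := enum_valP k; rewrite inE => /andP[lt_k e_k].
by exists (enum_val k).1, (enum_val k).2.
Qed.

Theorem theorem3p3 (K : fieldType) (n m : nat) (e : rel 'I_n)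
  (e_sym : ssrbool.symmetric e) (e_irr : irreflexive e)
  (e_conn : connected_graph e) (e_size : #|edges e| = m) :
  is_bar (binomial_edge_ideal K e) m /\ is_ara_c (binomial_edge_ideal K e) m.
Proof.
subst m; set J := binomial_edge_ideal K e.
pose B (k : 'I_#|edges e|) := edge_binomial K (enum_val k).1 (enum_val k).2.
have BJ k : J (B k) by apply/edge_binomials_generate/ideal_gen_incl; exists k.
have Bbin k : is_binomial (B k).
  by rewrite /B /edge_binomial -!mpolyXD; eexists; eexists; reflexivity.
have radB : same_radical J (family_ideal B).
  by move=> f; split=> -[k Jk]; exists k; apply/edge_binomials_generate.
split; split.
- by exists B.
(* Binomials of [J] are complete, so the bound for complete families applies to them. *)
- move=> t [F [cF]]; apply: complete_family_size => l.
  by have [JF binF] := cF l; exact: binomial_complete JF binF.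
- by exists B; split=> // k; exact: binomial_complete (BJ k) (Bbin k).
- by move=> t [F [cF]]; apply: complete_family_size.
Qed.
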